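(* Let \[ \alpha(n)=\min\{\lambda_1(G): G \text{ is a simple connected graph on } n \text{ vertices}\}. \] Then $\alpha(n)\sim \dfrac{54}{n^3}$ as $n\to\infty$, i.e. $\alpha(n)\,n^3/54\to 1$.
   Context: For a simple graph $G$ with degree function $d$, the normalized Laplacian is $\mathcal{L}=I-T^{-1/2}AT^{-1/2}$, where $A$ is the adjacency matrix and $T$ the diagonal degree matrix. Its eigenvalues are $0=\lambda_0\le\lambda_1\le\dots\le\lambda_{n-1}$, and $\lambda_1(G)$ denotes the second smallest one (the spectral gap). *)

(* Defs.v *)
(* Real numbers are modelled by an arbitrary Archimedean
   real closed field R (e.g. the real algebraic numbers or the reals). *)
From HB Require Import structures.
From mathcomp Require Import all_boot all_order all_algebra.
From Stdlib Require Import ClassicalEpsilon.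
Set Implicit Arguments. Unset Strict Implicit. Unset Printing Implicit Defensive.
Import Order.TTheory GRing.Theory Num.Theory.
Local Open Scope ring_scope.

Section Graphs.
Variable R : archiRcfType.

Definition simple_graph (n : nat) (e : rel 'I_n) : Prop :=
  (forall i, ~~ e i i) /\ (forall i j, e i j = e j i).

Definition connected_graph (n : nat) (e : rel 'I_n) : Prop :=
  forall i j, connect e i j.

Definition adj_mx (n : nat) (e : rel 'I_n) : 'M[R]_n :=
  \matrix_(i, j) (e i j)%:R.

Definition deg (n : nat) (e : rel 'I_n) (i : 'I_n) : R :=
  (#|[set j | e i j]|)%:R.

Definition norm_lap (n : nat) (e : rel 'I_n) : 'M[R]_n :=
  1%:M - \matrix_(i, j) ((Num.sqrt (deg e i))^-1 * adj_mx e i j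
                          * (Num.sqrt (deg e j))^-1).

Definition sorted_spectrum (n : nat) (M : 'M[R]_n) (s : seq R) : Prop :=
  sorted <=%R s /\ char_poly M = \prod_(x <- s) ('X - x%:P).

Definition is_lambda1 (n : nat) (e : rel 'I_n) (l : R) : Prop :=
  exists s, sorted_spectrum (norm_lap e) s /\ l = s`_1.

Definition lambda1 (n : nat) (e : rel 'I_n) : R :=
  epsilon (inhabits 0) (is_lambda1 e).

Definition is_alpha (n : nat) (a : R) : Prop :=
  (exists e : rel 'I_n, [/\ simple_graph e, connected_graph e & lambda1 e = a])
  /\ (forall e : rel 'I_n, simple_graph e -> connected_graph e -> a <= lambda1 e).

Definition alpha (n : nat) : R := epsilon (inhabits 0) (is_alpha n).

End Graphs.

(* Main.v *)
(* Upper bound: two cliques on n/3 vertices joined by a path with n/3 edges, tested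
   on the function that is constant on the cliques and linear along the path.

   Lower bound: let h be an eigenfunction for lambda_1, rescaled to have minimum 0 and
   maximum 1. A shortest path with k edges from the minimum to the maximum forces energy
   at least 1/k. Every vertex has at most 3 neighbours on it, so up to O(n) the
   volume is carried by the edges inside the set S of the N <= n - k remaining vertices.
   If lambda_1 < 54/n^3, the energy is O(1/n), so every edge is short for h; hence
   a vertex of S only sees vertices of S on its own side of any threshold c, unless
   its value is within O(n^(-1/2)) of c. Choosing c so that at most (1-c)N vertices
   of S lie below it and at most cN above it, the weighted second moment of h about c is
   at most 2 (c (1-c) N)^2 + O(n) <= N^2/8 + O(n). As k N^2 <= 4n^3/27, this yields
   lambda_1 >= 54 / (n^3 + O(n^2)). *)
Require Import Defs.
From HB Require Import structures.
From mathcomp Require Import all_boot all_order all_fingroup all_algebra.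
From mathcomp Require Import complex spectral ring lra zify.
From Stdlib Require Import ClassicalEpsilon.
Import Order.TTheory GRing.Theory Num.Theory.
Local Open Scope ring_scope.
Set Implicit Arguments. Unset Strict Implicit. Unset Printing Implicit Defensive.

(** * Second eigenvalue of a symmetric matrix *)

Lemma char_poly_conj (F : fieldType) n (P D : 'M[F]_n) :
  P \in unitmx -> char_poly (invmx P *m D *m P) = char_poly D.
Proof.
move=> uP; rewrite /char_poly /char_poly_mx !map_mxM.
set Q := map_mx _ P; set Q' := map_mx _ (invmx P).
have QQ : Q' *m Q = 1%:M by rewrite /Q /Q' -map_mxM mulVmx // map_mx1.
have -> : 'X%:M - Q' *m map_mx polyC D *m Q = Q' *m ('X%:M - map_mx polyC D) *m Q.
  by rewrite mulmxBr mulmxBl mul_mx_scalar -scalemxAl QQ scalemx1.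
by rewrite !det_mulmx mulrC mulrA -det_mulmx (mulmx1C QQ) det1 mul1r.
Qed.

Section SymmetricMatrices.
Local Open Scope sesquilinear_scope.
Variable R : rcfType.
Local Notation C := R[i].
Local Notation rc := (real_complex R).

Definition qform n (M : 'M[R]_n) (x : 'rV[R]_n) : R := (x *m M *m x^T) 0 0.
Definition sqnorm n (x : 'rV[R]_n) : R := (x *m x^T) 0 0.

Lemma qform0 n (M : 'M[R]_n) : qform M 0 = 0.
Proof. by rewrite /qform !mul0mx mxE. Qed.

Lemma sqnorm0 n : sqnorm (0 : 'rV[R]_n) = 0.
Proof. by rewrite /sqnorm mul0mx mxE. Qed.

(** The spectral theorem for Hermitian matrices applies after embedding [M] into [R[i]]. The
    eigenvalues [d] are real, while the unitary [P] stays complex, so the later variational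
    arguments work with complex vectors and return to their real and imaginary parts. *)
Lemma sym_diagonalization n (M : 'M[R]_n) : M^T = M ->
  exists P : 'M[C]_n, exists d : 'rV[R]_n, P \is unitarymx /\
    map_mx rc M = P^t* *m diag_mx (map_mx rc d) *m P.
Proof.
move=> MT; set A := map_mx rc M.
have Ah : A \is hermsymmx.
  apply: realsym_hermsym.
    apply/is_hermitianmxP; rewrite expr0 scale1r map_mx_id //.
    by rewrite /A map_trmx MT.
  by apply/mxOverP => i j; rewrite mxE; apply/complex_realP; exists (M i j).
have /hermitian_normalmx/orthomx_spectralP Ae := Ah.
have dr := hermitian_spectral_diag_real Ah.
exists (spectralmx A), (map_mx (@complex.Re R) (spectral_diag A)).
have uP := spectral_unitarymx A; split=> //.
rewrite -(invmx_unitary uP); apply: etrans Ae _; congr (_ *m diag_mx _ *m _).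
apply/rowP => i; rewrite !mxE; apply/esym/RRe_real.
by have /mxOverP := dr; apply.
Qed.

(** The mixed terms in the real and imaginary parts cancel because [M] is symmetric. *)
Lemma qform_complex n (M : 'M[R]_n) (z : 'rV[C]_n) : M^T = M ->
  (z *m map_mx rc M *m z^t*) 0 0 =
  rc (qform M (map_mx (@complex.Re R) z) + qform M (map_mx (@complex.Im R) z)).
Proof.
move=> MT; set x := map_mx _ z; set y := map_mx (@complex.Im R) z.
have zE : z = map_mx rc x + 'i%C *: map_mx rc y.
  by apply/rowP => i; rewrite !mxE; apply: complexE.
have zcE : z^t* = map_mx rc x^T - 'i%C *: map_mx rc y^T.
  apply/colP => i; rewrite !mxE.
  case: (z 0 i) => a b; apply/eqP; rewrite eq_complex /=.
  by rewrite !(mul0r, mul1r, oppr0, addr0, subr0, add0r, sub0r) !eqxx.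
have sw : map_mx rc x *m map_mx rc M *m map_mx rc y^T =
          map_mx rc y *m map_mx rc M *m map_mx rc x^T.
  rewrite -!map_mxM; congr (map_mx _ _).
  apply/trmx_inj; rewrite 2!trmx_mul trmxK MT mulmxA.
  by apply/matrixP => i j; rewrite [RHS]mxE !ord1.
rewrite zcE {1}zE mulmxBr !mulmxDl -!scalemxAr -!scalemxAl sw scalerA.
rewrite (_ : 'i%C * 'i%C = -1); last by rewrite -expr2 sqr_i.
rewrite scaleN1r opprB addrACA subrr addr0 -!map_mxM /qform rmorphD.
by rewrite !mxE.
Qed.

Lemma sqnorm_complex n (z : 'rV[C]_n) :
  (z *m z^t*) 0 0 =
  rc (sqnorm (map_mx (@complex.Re R) z) + sqnorm (map_mx (@complex.Im R) z)).
Proof.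
have := @qform_complex n 1%:M z (trmx1 _ _).
by rewrite map_mx1 /qform !mulmx1.
Qed.

Lemma sqnormE n (x : 'rV[R]_n) : sqnorm x = \sum_i x 0 i ^+ 2.
Proof. by rewrite /sqnorm mxE; apply: eq_bigr => i _; rewrite mxE expr2. Qed.

Lemma sqnorm_ge0 n (x : 'rV[R]_n) : 0 <= sqnorm x.
Proof. by rewrite sqnormE sumr_ge0 // => i _; rewrite sqr_ge0. Qed.

Lemma sqnorm_eq0 n (x : 'rV[R]_n) : (sqnorm x == 0) = (x == 0).
Proof.
rewrite sqnormE psumr_eq0 => [|i _]; last exact: sqr_ge0.
apply/allP/eqP => [x0|-> i _]; last by rewrite mxE expr2 mul0r eqxx.
apply/rowP => i; rewrite mxE; apply/eqP.
by have := x0 i (mem_index_enum i); rewrite sqrf_eq0.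
Qed.

Lemma spectrum_diag n (M : 'M[R]_n) (P : 'M[C]_n) (d : 'rV[R]_n) :
  P \is unitarymx ->
  map_mx rc M = P^t* *m diag_mx (map_mx rc d) *m P ->
  char_poly M = \prod_i ('X - (d 0 i)%:P).
Proof.
move=> uP Me; apply: (map_poly_inj rc).
rewrite map_char_poly Me -invmx_unitary // char_poly_conj ?unitarymx_unit //.
rewrite char_poly_trig ?diag_mx_is_trig // rmorph_prod.
by apply: eq_bigr => i _; rewrite rmorphB /= map_polyX map_polyC !mxE eqxx.
Qed.

Lemma sorted_spectrum_exists n (M : 'M[R]_n) : M^T = M ->
  exists s, sorted <=%R s /\ char_poly M = \prod_(x <- s) ('X - x%:P).
Proof.
move=> /sym_diagonalization[P [d [uP Me]]].
exists (sort <=%R [seq d 0 i | i : 'I_n]); split.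
  exact: sort_le_sorted.
rewrite (spectrum_diag uP Me) (perm_big [seq d 0 i | i : 'I_n]).
  by rewrite big_map enumT.
by rewrite perm_sort.
Qed.

End SymmetricMatrices.

Section SecondEigenvalue.
Local Open Scope sesquilinear_scope.
Variable R : rcfType.
Local Notation C := R[i].
Local Notation rc := (real_complex R).

Lemma second_smallest n (d : 'I_n -> R) (s : seq R) : (1 < n)%N ->
  sorted <=%R s -> perm_eq s [seq d i | i : 'I_n] ->
  exists i0 i1, [/\ i0 != i1, d i0 <= s`_1, d i1 = s`_1 &
                    forall j, j != i0 -> s`_1 <= d j].
Proof.
move=> n1 ss; rewrite (_ : [seq d i | i : 'I_n] = [tuple d i | i < n]) //.
move=> /tuple_permP[p sE].
have sz : size s = n by rewrite sE size_tuple.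
have sn i : s`_(val i) = d (p i).
  by rewrite sE -tnth_nth !tnth_mktuple.
pose o0 := Ordinal (ltnW n1); pose o1 := Ordinal n1.
exists (p o0), (p o1); split.
- by rewrite (inj_eq perm_inj).
- by rewrite -sn; apply: (le_sorted_leq_nth 0 ss); rewrite ?inE ?sz //= ltnW.
- by rewrite -sn.
move=> j jp; rewrite -(permKV p j) -sn.
apply: (le_sorted_leq_nth 0 ss); rewrite ?inE ?sz //=.
rewrite lt0n; apply: contraNneq jp => jp0.
by rewrite -(permKV p j) (inj_eq perm_inj) -val_eqE /= jp0.
Qed.

(** A linear form on a plane has a nonzero kernel vector: this is the dimension count behind both
    min-max inequalities below. *)
Lemma plane_kernel (K : idomainType) (a b : K) :
  exists x y : K, x * a + y * b = 0 /\ ((x != 0) || (y != 0)).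
Proof.
have [a0|a0] := eqVneq a 0; last by exists b, (- a); split; [ring|rewrite oppr_eq0 a0 orbT].
by exists 1, 0; rewrite a0 oner_neq0; split; first ring.
Qed.

Lemma qform_diag n (M : 'M[R]_n) (P : 'M[C]_n) (d : 'rV[R]_n) (c : 'rV[C]_n) :
  P \is unitarymx ->
  map_mx rc M = P^t* *m diag_mx (map_mx rc d) *m P ->
  ((c *m P) *m map_mx rc M *m (c *m P)^t*) 0 0 =
  \sum_i rc (d 0 i) * `|c 0 i| ^+ 2.
Proof.
move=> uP ->; rewrite trmx_mul map_mxM !mulmxA !mulmxtVK // mul_mx_diag mxE.
apply: eq_bigr => i _; rewrite !mxE normCK; ring.
Qed.

Lemma sqnorm_diag n (P : 'M[C]_n) (c : 'rV[C]_n) :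
  P \is unitarymx ->
  ((c *m P) *m (c *m P)^t*) 0 0 = \sum_i `|c 0 i| ^+ 2.
Proof.
move=> uP; rewrite trmx_mul map_mxM !mulmxA !mulmxtVK // mxE.
by apply: eq_bigr => i _; rewrite !mxE normCK.
Qed.

Lemma second_eigenvalue_le n (M : 'M[R]_n) (s : seq R) (w g : 'rV[R]_n) (mu : R) :
  (1 < n)%N -> M^T = M -> sorted <=%R s ->
  char_poly M = \prod_(x <- s) ('X - x%:P) ->
  (forall a b, a *: w + b *: g = 0 -> a = 0 /\ b = 0) ->
  (forall a b, qform M (a *: w + b *: g) <= mu * sqnorm (a *: w + b *: g)) ->
  s`_1 <= mu.
Proof.
move=> n1 MT ss ch free le_mu.
have [P [d [uP Me]]] := sym_diagonalization MT.
have ps : perm_eq s [seq d 0 i | i : 'I_n].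
  by apply: prod_XsubC_eq; rewrite -ch (spectrum_diag uP Me) big_map enumT.
have [i0 [i1 [_ _ _ dge]]] := second_smallest n1 ss ps.
pose cw := map_mx rc w *m P^t*; pose cg := map_mx rc g *m P^t*.
have [al [be [ab0 abn]]] := plane_kernel (cw 0 i0) (cg 0 i0).
pose z := al *: map_mx rc w + be *: map_mx rc g.
pose c := z *m P^t*.
have zE : z = c *m P by rewrite /c mulmxKtV.
have c0 : c 0 i0 = 0.
  by rewrite /c /z mulmxDl -!scalemxAl mxE [X in X + _]mxE [X in _ + X]mxE.
have zRe : map_mx (@complex.Re R) z = complex.Re al *: w + complex.Re be *: g.
  apply/rowP => i; rewrite !mxE.
  by case: (al) (be) => [a1 a2] [b1 b2] /=; rewrite !mulr0 !subr0.
have zIm : map_mx (@complex.Im R) z = complex.Im al *: w + complex.Im be *: g.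
  apply/rowP => i; rewrite !mxE.
  by case: (al) (be) => [a1 a2] [b1 b2] /=; rewrite !mulr0 !add0r.
have nz : 0 < sqnorm (map_mx (@complex.Re R) z) + sqnorm (map_mx (@complex.Im R) z).
  rewrite lt0r addr_ge0 ?sqnorm_ge0 // andbT paddr_eq0 ?sqnorm_ge0 //.
  rewrite !sqnorm_eq0 zRe zIm; apply/negP => /andP[/eqP/free[h1 h2] /eqP/free[h3 h4]].
  have al0 : al = 0 by rewrite (complexE al) h1 h3 mulr0 addr0.
  have be0 : be = 0 by rewrite (complexE be) h2 h4 mulr0 addr0.
  by move: abn; rewrite al0 be0 eqxx.
rewrite -(ler_pM2r nz).
apply: le_trans (_ : _ <= qform M (map_mx (@complex.Re R) z) +
                          qform M (map_mx (@complex.Im R) z)) _.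
  rewrite -lecR rmorphM /= -sqnorm_complex -qform_complex //.
  rewrite {1 2}zE sqnorm_diag // {1 2}zE (qform_diag _ uP Me) mulr_sumr.
  apply: ler_sum => i _; have [->|ne] := eqVneq i i0.
    by rewrite c0 normr0 expr0n /= !mulr0.
  by apply: ler_wpM2r; rewrite ?exprn_ge0 // lecR dge.
by rewrite mulrDr; apply: lerD; rewrite ?zRe ?zIm le_mu.
Qed.

(** The other half of Courant-Fischer. Some nonzero combination of the eigenvectors of the two
    smallest eigenvalues is orthogonal to [w]. Its real and imaginary parts are then both orthogonal
    to [w], and at least one of them is nonzero with a small enough Rayleigh quotient. *)
Lemma second_eigenvalue_ge n (M : 'M[R]_n) (s : seq R) (w : 'rV[R]_n) :
  (1 < n)%N -> M^T = M -> sorted <=%R s ->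
  char_poly M = \prod_(x <- s) ('X - x%:P) ->
  exists x : 'rV[R]_n, [/\ x != 0, (x *m w^T) 0 0 = 0 &
                           qform M x <= s`_1 * sqnorm x].
Proof.
move=> n1 MT ss ch.
have [P [d [uP Me]]] := sym_diagonalization MT.
have ps : perm_eq s [seq d 0 i | i : 'I_n].
  by apply: prod_XsubC_eq; rewrite -ch (spectrum_diag uP Me) big_map enumT.
have [i0 [i1 [ne01 d0 d1 _]]] := second_smallest n1 ss ps.
pose v := P *m map_mx rc w^T.
have [al [be [ab0 abn]]] := plane_kernel (v i0 0) (v i1 0).
pose c : 'rV[C]_n := al *: delta_mx 0 i0 + be *: delta_mx 0 i1.
have cz i : i != i0 -> i != i1 -> c 0 i = 0.
  by move=> /negbTE h0 /negbTE h1; rewrite !mxE h0 h1 !mulr0 addr0.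
pose z := c *m P.
pose x := map_mx (@complex.Re R) z; pose y := map_mx (@complex.Im R) z.
have zw : z *m map_mx rc w^T = 0.
  apply/rowP => j; rewrite ord1 [RHS]mxE -ab0 /z -mulmxA -/v /c mulmxDl -!scalemxAl.
  by rewrite -!rowE !mxE.
have zE : z = map_mx rc x + 'i%C *: map_mx rc y.
  by apply/rowP => i; rewrite !mxE; apply: complexE.
have : rc ((x *m w^T) 0 0) + 'i%C * rc ((y *m w^T) 0 0) = 0.
  have := congr1 (fun A : 'M[C]_1 => A 0 0) zw.
  rewrite zE mulmxDl -scalemxAl -!map_mxM.
  set X := x *m _; set Y := y *m _.
  by rewrite !mxE.
move=> /eqP; rewrite eq_complex /= !(mul0r, mulr0, mul1r, subr0, addr0, add0r).
move=> /andP[/eqP xw /eqP yw].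
have le : qform M x + qform M y <= s`_1 * (sqnorm x + sqnorm y).
  rewrite -lecR rmorphM /= -sqnorm_complex -qform_complex //.
  rewrite sqnorm_diag // (qform_diag _ uP Me) mulr_sumr.
  apply: ler_sum => i _.
  have [->|h0] := eqVneq i i0; first by apply: ler_wpM2r; rewrite ?exprn_ge0 // lecR.
  have [->|h1] := eqVneq i i1; first by rewrite d1.
  by rewrite cz // normr0 expr0n /= !mulr0.
have nz : (x != 0) || (y != 0).
  apply: contraTT abn; rewrite !negb_or !negbK => /andP[/eqP x0 /eqP y0].
  have z0 : z = 0.
    apply/rowP => i; rewrite (complexE (z 0 i)).
    have := congr1 (fun A : 'rV[R]_n => A 0 i) x0; rewrite !mxE => ->.
    have := congr1 (fun A : 'rV[R]_n => A 0 i) y0; rewrite !mxE => ->.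
    by rewrite mulr0 addr0.
  have c0 : c = 0.
    by rewrite -[c](mulmxtVK _ uP) -/z z0 mul0mx.
  have := congr1 (fun A : 'rV[C]_n => A 0 i0) c0.
  rewrite !mxE !eqxx (negbTE ne01) mulr1 mulr0 addr0 => ->.
  have := congr1 (fun A : 'rV[C]_n => A 0 i1) c0.
  by rewrite !mxE !eqxx eq_sym (negbTE ne01) mulr1 mulr0 add0r => ->; rewrite eqxx.
have [lx|lx] := leP (qform M x) (s`_1 * sqnorm x).
  have [x0|x0] := eqVneq x 0; last by exists x.
  exists y; split => //; first by move: nz; rewrite x0 eqxx.
  by move: le; rewrite x0 qform0 sqnorm0 !add0r.
exists y; split => //; last first.
  by move: le; rewrite mulrDr; lra.
apply: contraTneq le => ->.
by rewrite -ltNge qform0 sqnorm0 !addr0.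
Qed.

End SecondEigenvalue.

(** * Rayleigh quotients of the normalized Laplacian *)

Section Rayleigh.
Variable R : archiRcfType.

(* Sum over ordered pairs: twice the Dirichlet form. *)
Definition energy n (e : rel 'I_n) (f : 'I_n -> R) : R :=
  \sum_i \sum_j (e i j)%:R * (f i - f j) ^+ 2.

Lemma energy_ge0 n (e : rel 'I_n) f : 0 <= energy e f.
Proof. by do 2!apply: sumr_ge0 => ? _; rewrite mulr_ge0 ?ler0n ?sqr_ge0. Qed.

Lemma degE n (e : rel 'I_n) i : deg R e i = \sum_j (e i j)%:R.
Proof.
rewrite /deg -sum1_card natr_sum [RHS](bigID (e i)) /=.
rewrite [X in _ + X]big1 ?addr0 => [|j /negbTE-> //].
by apply: eq_big => [j|j]; rewrite inE // => ->.
Qed.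

Lemma deg_gt0 n (e : rel 'I_n) i : (1 < n)%N -> connected_graph e -> 0 < deg R e i.
Proof.
move=> n1 ce; rewrite /deg ltr0n card_gt0; apply/set0Pn.
have [j ji] : exists j : 'I_n, j != i.
  have : (0 < #|predC1 i|)%N by rewrite cardC1 card_ord; case: n n1 {e ce i} => [|[]].
  by case/card_gt0P => j; rewrite inE => ji; exists j.
have /connectP[[|k p] /= pp jl] := ce i j; first by rewrite jl eqxx in ji.
by exists k; rewrite inE; case/andP: pp.
Qed.

Lemma norm_lap_sym n (e : rel 'I_n) : simple_graph e -> (norm_lap R e)^T = norm_lap R e.
Proof.
move=> [_ se]; rewrite /norm_lap linearB /= trmx1; congr (_ - _).
by apply/matrixP => i j; rewrite !mxE se; ring.
Qed.

Lemma lambda1P n (e : rel 'I_n) : simple_graph e -> is_lambda1 e (lambda1 R e).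
Proof.
move=> se; apply: epsilon_spec.
have [s sP] := sorted_spectrum_exists (norm_lap_sym se).
by exists s`_1, s.
Qed.

(** The substitution x = T^(1/2) f, which turns the quadratic form of the normalized Laplacian into
    the Dirichlet form of f and constants into its kernel. *)
Definition scaled n (e : rel 'I_n) (f : 'I_n -> R) : 'rV[R]_n :=
  \row_i (Num.sqrt (deg R e i) * f i).

Section Fixed.
Variables (n : nat) (e : rel 'I_n).
Hypotheses (n1 : (1 < n)%N) (se : simple_graph e) (ce : connected_graph e).
Local Notation d := (deg R e).

Let sqrt_neq0 i : Num.sqrt (d i) != 0.
Proof. by rewrite gt_eqF // sqrtr_gt0 deg_gt0. Qed.

Let sqrtK i : Num.sqrt (d i) * Num.sqrt (d i) = d i.
Proof. by rewrite -expr2 sqr_sqrtr // ltW // deg_gt0. Qed.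

Lemma sqnorm_scaled f : sqnorm (scaled e f) = \sum_i d i * f i ^+ 2.
Proof. by rewrite sqnormE; apply: eq_bigr => i _; rewrite mxE exprMn expr2 sqrtK. Qed.

Lemma scaled_dot f g : (scaled e f *m (scaled e g)^T) 0 0 = \sum_i d i * f i * g i.
Proof. by rewrite mxE; apply: eq_bigr => i _; rewrite !mxE -[in RHS]sqrtK; ring. Qed.

Lemma qform_norm_lap f : 2 * qform (norm_lap R e) (scaled e f) = energy e f.
Proof.
have [_ sym] := se.
have -> : energy e f = 2 * (\sum_i d i * f i ^+ 2) - 2 * (\sum_j \sum_i (e i j)%:R * f i * f j).
  have -> : energy e f = \sum_i \sum_j ((e i j)%:R * f i ^+ 2) +
     \sum_i \sum_j ((e i j)%:R * f j ^+ 2) - 2 * (\sum_i \sum_j (e i j)%:R * f i * f j).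
    rewrite mulr_sumr -big_split /= -sumrB; apply: eq_bigr => i _.
    rewrite mulr_sumr -big_split /= -sumrB; apply: eq_bigr => j _; ring.
  have e1 : \sum_i \sum_j ((e i j)%:R * f i ^+ 2) = \sum_i d i * f i ^+ 2.
    by apply: eq_bigr => i _; rewrite degE mulr_suml.
  have -> : \sum_i \sum_j ((e i j)%:R * f j ^+ 2) = \sum_i d i * f i ^+ 2.
    by rewrite exchange_big /= -e1; do 2!apply: eq_bigr => ? _; rewrite sym.
  by rewrite e1 exchange_big /=; ring.
rewrite -mulrBr; congr (2 * _).
rewrite /qform /norm_lap mulmxBr mulmx1 mulmxBl mxE -sqnorm_scaled; congr (_ + _).
rewrite !mxE; congr (- _); apply: eq_bigr => j _.
rewrite !mxE mulr_suml; apply: eq_bigr => i _; rewrite !mxE.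
by field; rewrite !sqrt_neq0.
Qed.

(** The test plane is spanned by the constants and [f]. Adding a constant leaves the energy
    unchanged and, [f] having weighted mean zero, can only increase the weighted norm, so the
    quotient of [f] bounds the whole plane. *)
Lemma lambda1_le f : \sum_i d i * f i = 0 -> (exists i, f i != 0) ->
  2 * lambda1 R e * (\sum_i d i * f i ^+ 2) <= energy e f.
Proof.
move=> f0 [i0 fi0].
have [s [[ss ch] ->]] := lambda1P se.
set q := \sum_i _.
have q0 : 0 < q.
  rewrite /q (bigD1 i0) //=; apply: ltr_pwDl.
    by rewrite mulr_gt0 ?deg_gt0 // exprn_even_gt0.
  by apply: sumr_ge0 => i _; rewrite mulr_ge0 ?sqr_ge0 // ltW // deg_gt0.
rewrite -ler_pdivlMr // mulrC -ler_pdivlMr //.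
have lin a b : a *: scaled e (fun=> 1) + b *: scaled e f = scaled e (fun i => a + b * f i).
  by apply/rowP => i; rewrite !mxE; ring.
have dsum a b : \sum_i d i * (a + b * f i) = a * \sum_i d i.
  transitivity (a * (\sum_i d i) + b * (\sum_i d i * f i)); last by rewrite f0 mulr0 addr0.
  rewrite !mulr_sumr -big_split; apply: eq_bigr => i _ /=; ring.
have vol : 0 < \sum_i d i.
  by rewrite (bigD1 i0) //= ltr_pwDl ?deg_gt0 // sumr_ge0 // => i _; rewrite ltW // deg_gt0.
apply: (second_eigenvalue_le n1 (norm_lap_sym se) ss ch
          (w := scaled e (fun=> 1)) (g := scaled e f)).
  move=> a b; rewrite lin => /rowP z.
  have zi i : a + b * f i = 0.
    by have /eqP := z i; rewrite !mxE mulf_eq0 (negbTE (sqrt_neq0 i)) => /eqP.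
  have a0 : a = 0.
    have := dsum a b; rewrite big1 => [/esym/eqP|i _]; last by rewrite zi mulr0.
    by rewrite mulf_eq0 (gt_eqF vol) orbF => /eqP.
  split=> //; have /eqP := zi i0.
  by rewrite a0 add0r mulf_eq0 (negbTE fi0) orbF => /eqP.
move=> a b; rewrite lin sqnorm_scaled -(ler_pM2l (ltr0n R 2)) qform_norm_lap.
have -> : energy e (fun i => a + b * f i) = b ^+ 2 * energy e f.
  by rewrite mulr_sumr; apply: eq_bigr => i _; rewrite mulr_sumr; apply: eq_bigr => j _; ring.
have -> : \sum_i d i * (a + b * f i) ^+ 2 = a ^+ 2 * (\sum_i d i) + b ^+ 2 * q.
  transitivity (a ^+ 2 * (\sum_i d i) + b ^+ 2 * q + 2 * a * b * \sum_i d i * f i).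
    rewrite !mulr_sumr -!big_split; apply: eq_bigr => i _ /=; ring.
  by rewrite f0 mulr0 addr0.
have -> : 2 * (energy e f / q / 2 * (a ^+ 2 * (\sum_i d i) + b ^+ 2 * q)) =
   b ^+ 2 * energy e f + energy e f / q * (a ^+ 2 * (\sum_i d i)).
  by field; rewrite gt_eqF.
rewrite lerDl mulr_ge0 ?divr_ge0 ?energy_ge0 ?(ltW q0) //.
by rewrite mulr_ge0 ?sqr_ge0 // ltW.
Qed.

(** Orthogonality to the image of the constants becomes weighted mean zero once the vector is
    divided by the square roots of the degrees. *)
Lemma lambda1_attained : exists f, [/\ exists i, f i != 0, \sum_i d i * f i = 0 &
  energy e f <= 2 * lambda1 R e * (\sum_i d i * f i ^+ 2)].
Proof.
have [s [[ss ch] ->]] := lambda1P se.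
have [x [x0 xd xle]] := second_eigenvalue_ge (scaled e (fun=> 1)) n1 (norm_lap_sym se) ss ch.
pose f i := x 0 i / Num.sqrt (d i).
have xE : x = scaled e f by apply/rowP => i; rewrite mxE mulrC divfK.
exists f; split.
- by move: x0 => /rV0Pn[i xi]; exists i; rewrite mulf_neq0 // invr_eq0.
- by rewrite -[RHS]xd xE scaled_dot; apply: eq_bigr => i _; ring.
by rewrite -qform_norm_lap -mulrA ler_pM2l // -sqnorm_scaled -xE.
Qed.

End Fixed.
End Rayleigh.

(** * Geodesics and thresholds *)

(** Here [rho] stands for the distance from [u]. The record keeps what the argument uses of it:
    [rho] grows by at most one along an edge and inverts the path [p]. *)
Record geodesic n (e : rel 'I_n) (u v : 'I_n) (k : nat)
    (rho : 'I_n -> nat) (p : nat -> 'I_n) : Prop := Geodesic {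
  geo_lip : forall x y, e x y -> (rho y <= (rho x).+1)%N;
  geo_start : p 0%N = u;
  geo_end : p k = v;
  geo_edge : forall t, (t < k)%N -> e (p t) (p t.+1);
  geo_rho : forall t, (t <= k)%N -> rho (p t) = t }.

Lemma geodesic_exists n (e : rel 'I_n) u v : connected_graph e ->
  exists k rho p, geodesic e u v k rho p.
Proof.
move=> ce.
pose walk x m := [exists q : m.-tuple 'I_n, path e u q && (last u q == x)].
have walkP x (q : seq 'I_n) : path e u q -> last u q = x -> walk x (size q).
  by move=> pq lq; apply/existsP; exists (in_tuple q); rewrite /= pq lq eqxx.
have wex x : exists m, walk x m.
  by have /connectP[q pq lq] := ce u x; exists (size q); apply: walkP.
pose rho x := ex_minn (wex x).
have rhoW x : walk x (rho x) by rewrite /rho; case: ex_minnP.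
have rho_min x m : walk x m -> (rho x <= m)%N.
  by rewrite /rho; case: ex_minnP => ? _; apply.
have lip x y : e x y -> (rho y <= (rho x).+1)%N.
  move=> exy; have /existsP[q /andP[pq /eqP lq]] := rhoW x.
  rewrite -(size_tuple q) -(size_rcons q y); apply/rho_min/walkP.
    by rewrite rcons_path pq lq.
  by rewrite last_rcons.
have /existsP[q /andP[pq /eqP lq]] := rhoW v.
pose p t := nth u (u :: q) t.
have edge t : (t < rho v)%N -> e (p t) (p t.+1).
  by move=> tk; have /(pathP u) := pq; apply; rewrite size_tuple.
have pk : p (rho v) = v by rewrite /p -[RHS]lq (last_nth u) size_tuple.
exists (rho v), rho, p; split=> // t tk; apply/eqP; rewrite eqn_leq; apply/andP; split.
  have -> : t = size (take t q) by rewrite size_takel ?size_tuple.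
  apply/rho_min/walkP; first by rewrite take_path.
  rewrite (last_nth u) size_takel ?size_tuple // /p.
  by case: t tk => //= t tk; rewrite nth_take.
(* The prefix of the walk gave [rho (p t) <= t]. Conversely, the remaining [rho v - t] edges raise
   [rho] by at most one each and must end at the value [rho v]. *)
have climb j : (t + j <= rho v)%N -> (rho (p (t + j)%N) <= rho (p t) + j)%N.
  elim: j => [|j IH] tj; first by rewrite !addn0.
  rewrite addnS in tj *; rewrite addnS.
  by apply: leq_trans (lip _ _ (edge _ tj)) _; rewrite ltnS IH // ltnW.
have := climb (rho v - t)%N; rewrite subnKC // leqnn pk => /(_ isT); lia.
Qed.

Section Geodesic.
Variables (n : nat) (e : rel 'I_n) (u v : 'I_n) (k : nat).
Variables (rho : 'I_n -> nat) (p : nat -> 'I_n).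
Hypotheses (sym : forall i j, e i j = e j i) (gp : geodesic e u v k rho p).

(** Since [rho] inverts [p], the only index at which [x] can occur on the path is [rho x]. *)
Definition on_geodesic : {set 'I_n} := [set x | (rho x <= k)%N && (p (rho x) == x)].

Lemma card_on_geodesic : (k <= #|on_geodesic|)%N.
Proof.
have inj : injective (fun t : 'I_k.+1 => p t).
  move=> s t /(congr1 rho); rewrite !(geo_rho gp) -1?ltnS // => st; exact: val_inj.
apply: leq_trans (leqnSn k) _; rewrite -{1}(card_ord k.+1) -(card_codom inj).
apply/subset_leq_card/subsetP => _ /codomP[t ->].
by rewrite inE !(geo_rho gp) -1?ltnS // eqxx ltn_ord.
Qed.

(* A vertex at distance r from u only sees geodesic vertices at distance r - 1, r, r + 1. *)
Lemma geodesic_neighbours x : (#|[set y in on_geodesic | e x y]| <= 3)%N.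
Proof.
pose s := [:: p (rho x).-1; p (rho x); p (rho x).+1].
apply: leq_trans (card_size s); apply/subset_leq_card/subsetP => y.
rewrite !inE => /andP[/andP[_ /eqP py] exy].
have l1 := geo_lip gp exy; have l2 : (rho x <= (rho y).+1)%N.
  by apply: (geo_lip gp); rewrite sym.
have : [|| rho y == (rho x).-1, rho y == rho x | rho y == (rho x).+1] by lia.
by case/or3P => /eqP E; rewrite -E py eqxx ?orbT.
Qed.

Variable R : archiRcfType.

Lemma sum_inj_le (I T : finType) (g : I -> T) (F : T -> R) :
  injective g -> (forall x, 0 <= F x) -> \sum_i F (g i) <= \sum_x F x.
Proof.
move=> gi F0; rewrite -(big_imset F (A := predT)) /=; last by move=> ? ? _ _ /gi.
by rewrite big_mkcond; apply: ler_sum => x _; case: ifP.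
Qed.

(** Each path edge enters the sum over ordered pairs in both orientations. The values of [rho] at
    the two ends tell all these ordered pairs apart. *)
Lemma energy_path (h : 'I_n -> R) :
  2 * \sum_(t < k) (h (p t.+1) - h (p t)) ^+ 2 <= energy e h.
Proof.
pose g (tb : 'I_k * bool) := if tb.2 then (p tb.1, p tb.1.+1) else (p tb.1.+1, p tb.1).
pose F (xy : 'I_n * 'I_n) : R := (e xy.1 xy.2)%:R * (h xy.1 - h xy.2) ^+ 2.
have gi : injective g.
  move=> [s b] [t c]; rewrite /g /= => E.
  have := congr1 (fun xy => (rho xy.1, rho xy.2)) E.
  have ls := ltn_ord s; have lt := ltn_ord t.
  have ls' := ltnW ls; have lt' := ltnW lt.
  case: b c {E} => [] [] /=; rewrite !(geo_rho gp) //= => -[] st1 st2;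
    try (by exfalso; lia); congr (_, _); apply: val_inj => /=; lia.
have -> : energy e h = \sum_xy F xy by rewrite /energy pair_big.
apply: le_trans (sum_inj_le gi _) => [|xy]; last by rewrite mulr_ge0 ?sqr_ge0.
rewrite -(pair_big predT predT (fun t b => F (g (t, b)))) /= mulr_sumr.
apply: ler_sum => t _; rewrite big_bool /F /g /= [e (p t.+1) _]sym.
rewrite (geo_edge gp) // !mul1r; lra.
Qed.

Lemma energy_geodesic (h : 'I_n -> R) : h u = 0 -> h v = 1 -> 2 <= k%:R * energy e h.
Proof.
move=> hu hv.
have k0 : (0 < k)%N.
  rewrite lt0n; apply/eqP => k0; have /eqP := hv.
  by rewrite -(geo_end gp) k0 (geo_start gp) hu eq_sym oner_eq0.
have kR : 0 < k%:R :> R by rewrite ltr0n.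
have tele : \sum_(t < k) (h (p t.+1) - h (p t)) = 1.
  rewrite -(big_mkord predT (fun t => h (p t.+1) - h (p t))) telescope_sumr //.
  by rewrite (geo_start gp) (geo_end gp) hu hv subr0.
(* Cauchy-Schwarz, obtained from the variance of the increments about their mean 1/k. *)
have : 0 <= \sum_(t < k) (h (p t.+1) - h (p t) - k%:R^-1) ^+ 2.
  by apply: sumr_ge0 => t _; rewrite sqr_ge0.
have -> : \sum_(t < k) (h (p t.+1) - h (p t) - k%:R^-1) ^+ 2 =
  \sum_(t < k) (h (p t.+1) - h (p t)) ^+ 2 - k%:R^-1.
  transitivity (\sum_(t < k) (h (p t.+1) - h (p t)) ^+ 2 -
     2 * k%:R^-1 * (\sum_(t < k) (h (p t.+1) - h (p t))) + \sum_(t < k) k%:R^-1 ^+ 2).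
    by rewrite mulr_sumr -sumrB -big_split; apply: eq_bigr => t _ /=; ring.
  by rewrite tele sumr_const card_ord -mulr_natr; field; rewrite gt_eqF.
rewrite subr_ge0 -(ler_pM2l kR) divff ?gt_eqF // => le1.
have := energy_path h; rewrite -(ler_pM2l kR); lra.
Qed.

End Geodesic.

(** * Threshold and second moment for the vertices off the geodesic *)

Section Clusters.
Variables (R : archiRcfType) (T : finType) (S : {set T}) (h : T -> R).
Hypothesis h01 : forall x, 0 <= h x <= 1.

Let below c := #|[set x in S | h x < c]|.
Let above c := #|[set x in S | c < h x]|.

(* The crossing point of the nondecreasing map c |-> #{h < c} and the decreasing map
   c |-> (1 - c)|S|. *)
Lemma balanced_threshold : exists c, [/\ 0 <= c <= 1,
  (below c)%:R <= (1 - c) * #|S|%:R & (above c)%:R <= c * #|S|%:R].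
Proof.
have [S0|Sn0] := eqVneq S set0.
  exists 0; rewrite lexx ler01 /below /above; split=> //; rewrite S0 cards0.
    by rewrite mulr0 (eq_card0 (A := mem [set x in _ | _])) // => x; rewrite !inE.
  by rewrite mulr0 (eq_card0 (A := mem [set x in _ | _])) // => x; rewrite !inE.
have N0 : 0 < #|S|%:R :> R by rewrite ltr0n card_gt0.
(* The crossing point is reached without limits, as the maximum over [S] of the smaller of the two
   quantities. The bound on [below] follows from monotonicity at the maximiser. *)
pose m w := Num.min (h w) (1 - (below (h w))%:R / #|S|%:R).
have [w0 w0S] : exists w, w \in S by apply/set0Pn.
pose w := [arg max_(w > w0 in S) m w]%O.
have [wS wmax] : w \in S /\ forall x, x \in S -> m x <= m w.
  by rewrite /w; case: arg_maxP.
have m_ge0 : 0 <= m w.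
  rewrite /m le_min; have /andP[-> _] := h01 w.
  rewrite subr_ge0 ler_pdivrMr // mul1r ler_nat /below subset_leq_card //.
  by apply/subsetP => x; rewrite !inE => /andP[].
exists (m w); split.
- rewrite m_ge0 /= /m ge_min; have /andP[_ ->] // := h01 w.
- have mw1 : m w <= h w by rewrite /m ge_min lexx.
  have mw2 : (below (h w))%:R <= (1 - m w) * #|S|%:R.
    have : m w <= 1 - (below (h w))%:R / #|S|%:R by rewrite /m ge_min lexx orbT.
    by rewrite lerBrDr -lerBrDl ler_pdivrMr.
  apply: le_trans mw2; rewrite ler_nat /below subset_leq_card //.
  by apply/subsetP => x; rewrite !inE => /andP[-> /lt_le_trans->].
pose A := [set x in S | m w < h x]; rewrite /above -/A.
have [->|/set0Pn[y0 y0A]] := eqVneq A set0; first by rewrite cards0 mulr_ge0 ?ler0n.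
(* At the lowest vertex [y] strictly above the threshold, maximality forces the second term of the
   minimum to be at most [m w]. The vertices of [S] below [h y] are exactly those outside [A], which
   bounds the size of [A]. *)
pose y := [arg min_(y < y0 in A) h y]%O.
have [yA ymin] : y \in A /\ forall x, x \in A -> h y <= h x.
  by rewrite /y; case: arg_minP.
have /[!inE]/andP[yS ylt] := yA.
have := wmax y yS; rewrite {1}/m ge_min leNgt ylt /=.
have -> : (below (h y))%:R = #|S|%:R - #|A|%:R :> R.
  rewrite -natrB; last by apply/subset_leq_card/subsetP => x; rewrite !inE => /andP[].
  congr (_%:R); rewrite -(cardsID A S).
  have -> : S :&: A = A by apply/setIidPr/subsetP => x; rewrite !inE => /andP[].
  rewrite addKn; apply: eq_card => x; rewrite !inE.
  case: (boolP (x \in S)) => //= xS; rewrite andbT.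
  apply/idP/idP; last by rewrite -leNgt => /le_lt_trans; apply.
  by apply: contraTN => xm; rewrite -leNgt ymin // inE xS.
rewrite -(ler_pM2r N0) mulrBl divfK ?gt_eqF // mul1r; lra.
Qed.

(* Away from the threshold c, short edges cannot cross it, so a vertex sees
   only its own side; the two sides have at most (1-c)|S| and c|S| vertices. *)
Lemma short_edge_variance (e : rel T) (delta : R) :
  (forall x y, e x y -> (h x - h y) ^+ 2 <= delta) -> 0 <= delta ->
  exists c, 0 <= c <= 1 /\
  \sum_(x in S) #|[set y in S | e x y]|%:R * (h x - c) ^+ 2
    <= #|S|%:R ^+ 2 / 8 + #|S|%:R ^+ 2 * delta.
Proof.
move=> short d0; have [c [c01 bc ac]] := balanced_threshold; exists c; split=> //.
have /andP[c0 c1] := c01.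
set N : R := #|S|%:R; set a : R := (below c)%:R in bc; set b : R := (above c)%:R in ac.
have N0 : 0 <= N by rewrite ler0n.
(* Three regimes: within [delta] of the threshold (in square) the degree is bounded by [N]; farther
   away, every neighbour lies on the same side, giving at most [a] or [b] neighbours at distance at
   most [c] or [1 - c]. *)
have pw x : x \in S -> #|[set y in S | e x y]|%:R * (h x - c) ^+ 2 <=
    N * delta + (h x < c)%R%:R * (a * c ^+ 2) + (c < h x)%R%:R * (b * (1 - c) ^+ 2).
  move=> xS; have /andP[h0 h1] := h01 x.
  have ca : 0 <= a * c ^+ 2 by rewrite mulr_ge0 ?sqr_ge0 ?ler0n.
  have cb : 0 <= b * (1 - c) ^+ 2 by rewrite mulr_ge0 ?sqr_ge0 ?ler0n.
  have [near|far] := leP ((h x - c) ^+ 2) delta.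
    rewrite -addrA -[X in X <= _]addr0 lerD //; last by rewrite addr_ge0 // mulr_ge0.
    rewrite ler_pM ?ler0n ?sqr_ge0 // ler_nat subset_leq_card //.
    by apply/subsetP => y; rewrite inE => /andP[].
  have Nd : 0 <= N * delta by rewrite mulr_ge0.
  have side y : e x y -> delta < (h x - h y) ^+ 2 -> False.
    by move=> /short exy; rewrite ltNge exy.
  case: (ltgtP (h x) c) far => hc far; rewrite ?mul1r ?mul0r ?addr0.
  - apply: le_trans (_ : a * c ^+ 2 <= _); last by rewrite lerDr.
    apply: ler_pM; rewrite ?ler0n ?sqr_ge0 //; last by nra.
    rewrite ler_nat /below subset_leq_card //; apply/subsetP => y.
    rewrite !inE => /andP[-> exy] /=; rewrite ltNge; apply/negP => yc.
    by apply: (side y exy); apply: lt_le_trans far _; nra.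
  - apply: le_trans (_ : b * (1 - c) ^+ 2 <= _); last by rewrite lerDr.
    apply: ler_pM; rewrite ?ler0n ?sqr_ge0 //; last by nra.
    rewrite ler_nat /above subset_leq_card //; apply/subsetP => y.
    rewrite !inE => /andP[-> exy] /=; rewrite ltNge; apply/negP => yc.
    by apply: (side y exy); apply: lt_le_trans far _; nra.
  - by move: far; rewrite hc subrr expr0n /= ltNge d0.
apply: le_trans; first by apply: ler_sum => x; apply: pw.
rewrite !big_split /= sumr_const -[_ *+ #|_|]mulr_natl -/N.
have ind (P : pred T) r : \sum_(x in S) (P x)%:R * r = #|[set x in S | P x]|%:R * r :> R.
  rewrite -mulr_suml; congr (_ * _); rewrite -sum1_card natr_sum big_mkcond [RHS]big_mkcond.
  by apply: eq_bigr => x _; rewrite inE; case: (x \in S) => //=; case: (P x).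
rewrite !ind -/(below c) -/(above c) -/a -/b.
have a0 : 0 <= a by rewrite ler0n.
have b0 : 0 <= b by rewrite ler0n.
(* Summing the pointwise bound over one side brings a second factor [a] or [b]. Balance makes each
   side at most (c(1-c)N)^2, hence N^2/16, and the two together give N^2/8. *)
have A2 : a * (a * c ^+ 2) <= (c * (1 - c) * N) ^+ 2.
  have -> : a * (a * c ^+ 2) = (a * c) ^+ 2 by ring.
  by rewrite lerXn2r ?nnegrE; nra.
have B2 : b * (b * (1 - c) ^+ 2) <= (c * (1 - c) * N) ^+ 2.
  have -> : b * (b * (1 - c) ^+ 2) = (b * (1 - c)) ^+ 2 by ring.
  by rewrite lerXn2r ?nnegrE; nra.
have c14 : c * (1 - c) <= 1 / 4.
  have : 0 <= (c - 1 / 2) ^+ 2 by apply: sqr_ge0.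
  lra.
have cc0 : 0 <= c * (1 - c) by rewrite mulr_ge0 ?subr_ge0.
have C2 : (c * (1 - c) * N) ^+ 2 <= (1 / 4 * N) ^+ 2.
  by rewrite lerXn2r ?nnegrE ?ler_wpM2r // mulr_ge0 // divr_ge0.
have -> : N * (N * delta) = N ^+ 2 * delta by ring.
nra.
Qed.

End Clusters.

(** * Lower bound *)

Section LowerBound.
Variables (R : archiRcfType) (n : nat) (e : rel 'I_n).
Hypotheses (n1 : (1 < n)%N) (se : simple_graph e) (ce : connected_graph e).
Local Notation d := (deg R e).

Let sym : forall i j, e i j = e j i. Proof. by case: se. Qed.

Lemma deg_le i : d i <= n%:R.
Proof. by rewrite ler_nat -[leqRHS]card_ord max_card. Qed.

Lemma edge_energy (h : 'I_n -> R) x y : e x y -> 2 * (h x - h y) ^+ 2 <= energy e h.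
Proof.
move=> exy.
have xy : x != y by apply: contraTneq exy => ->; case: se.
have r0 i : 0 <= \sum_j (e i j)%:R * (h i - h j) ^+ 2.
  by apply: sumr_ge0 => j _; rewrite mulr_ge0 ?sqr_ge0.
have row i j : e i j -> (h i - h j) ^+ 2 <= \sum_j (e i j)%:R * (h i - h j) ^+ 2.
  move=> eij; rewrite (bigD1 j) //= eij mul1r lerDl; apply: sumr_ge0 => k _.
  by rewrite mulr_ge0 ?sqr_ge0.
have eyx : e y x by rewrite sym.
have rx := row _ _ exy; have ry := row _ _ eyx.
rewrite /energy (bigD1 x) //= [X in _ <= _ + X](bigD1 y) 1?eq_sym //=.
have rest : 0 <= \sum_(i | (i != x) && (i != y)) \sum_j (e i j)%:R * (h i - h j) ^+ 2.
  by apply: sumr_ge0.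
rewrite -[h y - h x]opprB sqrrN in ry; lra.
Qed.

(** All weights are at most 1. Double counting bounds the total degree of the geodesic vertices by
    3n, as each vertex has at most 3 neighbours there; discarding the geodesic neighbours of the
    vertices of [S] costs another 3n. *)
Lemma volume_split k rho p u v (h : 'I_n -> R) c
    (S := ~: on_geodesic k rho p) : geodesic e u v k rho p ->
  (forall x, 0 <= h x <= 1) -> 0 <= c <= 1 ->
  \sum_x d x * (h x - c) ^+ 2 <=
  6 * n%:R + \sum_(x in S) #|[set y in S | e x y]|%:R * (h x - c) ^+ 2.
Proof.
move=> gp h01 /andP[c0 c1]; pose P := on_geodesic k rho p.
have near x : 0 <= (h x - c) ^+ 2 <= 1.
  by rewrite sqr_ge0; have /andP[h0 h1] := h01 x; nra.
have dE x : d x = #|[set y in P | e x y]|%:R + #|[set y in S | e x y]|%:R.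
  rewrite -natrD /deg -(cardsID P [set j | e x j]); congr (_ + _)%N%:R.
    by apply: eq_card => y; rewrite !inE andbC.
  by apply: eq_card => y; rewrite !inE.
have P3 x : #|[set y in P | e x y]|%:R <= 3 :> R.
  by rewrite ler_nat (geodesic_neighbours sym gp).
rewrite (bigID (mem P)) /=.
have -> : 6 * n%:R = 3 * n%:R + 3 * n%:R :> R by ring.
rewrite -addrA; apply: lerD.
  apply: le_trans (_ : \sum_(x in P) d x <= _).
    apply: ler_sum => x _; rewrite ler_piMr ?ler0n //; by case/andP: (near x).
  have -> : \sum_(x in P) d x = \sum_y #|[set x in P | e y x]|%:R.
    under eq_bigr do rewrite degE.
    rewrite exchange_big /=; apply: eq_bigr => y _.
    rewrite -sum1_card natr_sum big_mkcond [RHS]big_mkcond; apply: eq_bigr => x _.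
    by rewrite inE [e y x]sym; case: (x \in P); case: (e x y).
  apply: le_trans (_ : \sum_(y : 'I_n) 3 <= _); first exact: ler_sum.
  by rewrite sumr_const card_ord -[_ *+ n]mulr_natr.
have -> : \sum_(x | x \notin P) d x * (h x - c) ^+ 2 = \sum_(x in S) d x * (h x - c) ^+ 2.
  by apply: eq_bigl => x; rewrite /S !inE.
apply: le_trans (_ : \sum_(x in S) (3 + #|[set y in S | e x y]|%:R * (h x - c) ^+ 2) <= _).
  apply: ler_sum => x _; rewrite dE mulrDl lerD2r.
  have /andP[s0 s1] := near x; apply: le_trans (P3 x).
  by rewrite ler_piMr.
rewrite big_split lerD2r /= sumr_const -[_ *+ #|_|]mulr_natr ler_pM2l ?ltr0n //.
by rewrite ler_nat -[leqRHS]card_ord max_card.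
Qed.

(** The Rayleigh inequality is assumed about every centre [c]. It is used first at 0, for a crude
    energy bound that makes all edges short, and then at the balanced threshold for the sharp
    estimate. *)
Lemma variational_bound (lam : R) (h : 'I_n -> R) u v : 0 <= lam ->
  (forall x, 0 <= h x <= 1) -> h u = 0 -> h v = 1 ->
  (forall c, energy e h <= 2 * lam * \sum_x d x * (h x - c) ^+ 2) ->
  54 <= lam * (n%:R ^+ 3 + 3240 * n%:R ^+ 2).
Proof.
move=> lam0 h01 hu hv var.
have [k [rho [p gp]]] := geodesic_exists u v ce.
have ken := energy_geodesic sym gp hu hv.
set S := ~: on_geodesic k rho p.
have kSn : k%:R + #|S|%:R <= n%:R :> R.
  rewrite -natrD ler_nat -[leqRHS]card_ord -(cardsC (on_geodesic k rho p)) leq_add2r.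
  exact: (card_on_geodesic gp).
set x := n%:R in kSn *.
have x0 : 0 < x by rewrite /x ltr0n ltnW.
(* Arguing by contradiction supplies the smallness of [lam] from which the edges are shown to be
   short. *)
rewrite leNgt; apply/negP => small.
have lamx : lam * x ^+ 3 <= 54.
  apply: le_trans (ltW small); rewrite ler_wpM2l // lerDl mulr_ge0 ?sqr_ge0 //.
have en : x * energy e h <= 108.
  apply: le_trans (_ : 2 * (lam * x ^+ 3) <= _); last by lra.
  have -> : 2 * (lam * x ^+ 3) = x * (2 * lam * x ^+ 2) by ring.
  rewrite ler_pM2l //; apply: le_trans (var 0) _.
  rewrite ler_wpM2l ?mulr_ge0 //.
  apply: le_trans (_ : \sum_(i < n) x <= _).
    apply: ler_sum => i _; rewrite subr0 -[leRHS]mulr1.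
    have /andP[h0 h1] := h01 i.
    by rewrite ler_pM ?ler0n ?sqr_ge0 ?deg_le // exprn_ile1.
  by rewrite sumr_const card_ord -[_ *+ n]mulr_natr expr2.
have short i j : e i j -> (h i - h j) ^+ 2 <= 54 / x.
  move=> /(edge_energy h) eh; rewrite ler_pdivlMr //.
  have := le_trans (ler_wpM2l (ltW x0) eh) en; lra.
have [|c [c01 cvar]] := short_edge_variance S h01 short.
  by rewrite divr_ge0 ?(ltW x0).
have vs := volume_split gp h01 c01; rewrite -/S -/x in vs.
set N : R := #|S|%:R in kSn cvar; set K : R := k%:R in kSn ken.
have N0 : 0 <= N by rewrite ler0n.
have K0 : 0 <= K by rewrite ler0n.
have Nd : N ^+ 2 * (54 / x) <= 54 * x.
  rewrite mulrA ler_pdivrMr //; nra.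
(* Here 60 = 6 + 54: 6 from the edges meeting the geodesic, 54 from the vertices near the threshold.
   Clearing the denominator 54 later gives 3240 = 54 * 60. *)
have total : \sum_i d i * (h i - c) ^+ 2 <= 60 * x + N ^+ 2 / 8.
  by apply: le_trans vs _; lra.
have two : 2 <= K * (2 * lam * (60 * x + N ^+ 2 / 8)).
  apply: le_trans ken _; rewrite ler_wpM2l //; apply: le_trans (var c) _.
  by rewrite ler_wpM2l // mulr_ge0.
(* AM-GM for K, N/2, N/2 *)
have amgm : 27 * (K * N ^+ 2) <= 4 * x ^+ 3.
  apply: le_trans (_ : 4 * (K + N) ^+ 3 <= _).
    rewrite -subr_ge0.
    have -> : 4 * (K + N) ^+ 3 - 27 * (K * N ^+ 2) = (K + 4 * N) * (N - 2 * K) ^+ 2 by ring.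
    by rewrite mulr_ge0 ?sqr_ge0 // addr_ge0 // mulr_ge0.
  by rewrite ler_wpM2l // lerXn2r ?nnegrE ?addr_ge0 // ltW.
have Kx : K * (60 * x) <= 60 * x ^+ 2 by nra.
have : K * (60 * x + N ^+ 2 / 8) <= (x ^+ 3 + 3240 * x ^+ 2) / 54 by lra.
move=> /(ler_wpM2l lam0); move: two small; lra.
Qed.

Lemma lambda1_lower : 54 <= lambda1 R e * (n%:R ^+ 3 + 3240 * n%:R ^+ 2).
Proof.
have [f [[i0 fi0] f0 fle]] := lambda1_attained R n1 se ce.
set lam := lambda1 R e in fle *; set q := \sum_i _ in fle.
have q0 : 0 < q.
  rewrite /q (bigD1 i0) //=; apply: ltr_pwDl.
    by rewrite mulr_gt0 ?deg_gt0 // exprn_even_gt0.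
  by apply: sumr_ge0 => i _; rewrite mulr_ge0 ?sqr_ge0 // ler0n.
have lam0 : 0 <= lam.
  by have := le_trans (energy_ge0 e f) fle; rewrite -mulrA pmulr_rge0 // pmulr_lge0.
pose u := [arg min_(i < i0) f i]%O; pose v := [arg max_(i > i0) f i]%O.
have umin i : f u <= f i by rewrite /u; case: arg_minP => // j _; apply.
have vmax i : f i <= f v by rewrite /v; case: arg_maxP => // j _; apply.
set W := f v - f u.
have vol : 0 < \sum_i d i.
  by rewrite (bigD1 i0) //= ltr_pwDl ?deg_gt0 // sumr_ge0 // => i _; rewrite ler0n.
have W0 : 0 < W.
  (* If the range were zero, [f] would be constant, and weighted mean zero would make it vanish. *)
  rewrite subr_gt0 lt_neqAle umin andbT; apply: contra_neq fi0 => uv.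
  have fc i : f i = f i0.
    by apply/eqP; rewrite eq_le (le_trans (vmax i)) -?uv // (le_trans (vmax i0)) -?uv.
  have /eqP := f0; under eq_bigr do rewrite fc.
  by rewrite -mulr_suml mulf_eq0 (gt_eqF vol) => /eqP.
pose h i := (f i - f u) / W.
have h01 i : 0 <= h i <= 1.
  by rewrite /h divr_ge0 ?subr_ge0 ?(ltW W0) //= ler_pdivrMr // mul1r lerD2r.
apply: (variational_bound (h := h) (u := u) (v := v)) => // [||c].
- by rewrite /h subrr mul0r.
- by rewrite /h divff ?gt_eqF.
have hE : energy e h = energy e f / W ^+ 2.
  rewrite /energy mulr_suml; apply: eq_bigr => i _; rewrite mulr_suml; apply: eq_bigr => j _.
  by rewrite /h; field; rewrite gt_eqF.
rewrite hE ler_pdivrMr ?exprn_gt0 //; apply: le_trans fle _.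
rewrite -[leRHS]mulrA ler_wpM2l ?mulr_ge0 //.
(* Parallel-axis identity: the mean of [f] is zero, so the second moment about any other centre is
   at least [q]. *)
have -> : (\sum_i d i * (h i - c) ^+ 2) * W ^+ 2 = q + (f u + c * W) ^+ 2 * \sum_i d i.
  transitivity (q - 2 * (f u + c * W) * (\sum_i d i * f i) + (f u + c * W) ^+ 2 * \sum_i d i).
    rewrite /q !mulr_sumr mulr_suml -sumrB -big_split /=; apply: eq_bigr => i _.
    by rewrite /h; field; rewrite gt_eqF.
  by rewrite f0 mulr0 subr0.
by rewrite lerDl mulr_ge0 ?sqr_ge0 // ltW.
Qed.

End LowerBound.

(** * Double kites *)

(** A path through all the vertices in order, with the first [q] and the last [q] of them made into
    cliques. For [q = 0] it is the bare path. *)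
Definition kite n q : rel 'I_n := fun i j => (i != j) &&
  [|| (i < q)%N && (j < q)%N, (n - q <= i)%N && (n - q <= j)%N, i.+1 == j | j.+1 == i].

Lemma kite_simple n q : simple_graph (@kite n q).
Proof.
split=> [i|i j]; first by rewrite /kite eqxx.
by rewrite /kite eq_sym [(j < q)%N && _]andbC [(n - q <= j)%N && _]andbC
   [(j.+1 == i) || _]orbC.
Qed.

Lemma kite_connected n q : connected_graph (@kite n q).
Proof.
have up (i j : 'I_n) : (i <= j)%N -> connect (@kite n q) i j.
  case: j => j jn /=; elim: j jn => [|j IH] jn ij.
    by rewrite (_ : Ordinal jn = i) ?connect0 //; apply: val_inj => /=; lia.
  have [ij'|ij'] := leqP i j; last first.
    by rewrite (_ : Ordinal jn = i) ?connect0 //; apply: val_inj => /=; lia.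
  apply: connect_trans (IH (ltnW jn) ij') (connect1 _).
  by rewrite /kite -val_eqE /= eqxx !orbT andbT neq_ltn leqnn.
have csym : connect_sym (@kite n q).
  by apply: sym_connect_sym => i j; case: (kite_simple n q).
by move=> i j; have [/up//|/ltnW/up] := leqP i j; rewrite csym.
Qed.

Section Kite.
Variables (R : archiRcfType) (n q : nat).
Hypotheses (q2 : (2 <= q)%N) (qn : (2 * q <= n)%N).
(** The number of path edges from [q - 1] to [n - q], the facing ends of the cliques. The test
    function rises by 2 on each of them, from [- L] to [L], which keeps it integral and odd under
    reversal. *)
Let L : R := n%:R + 1 - 2 * q%:R.

Definition kite_profile (i : nat) : R :=
  if (i < q)%N then - L else if (i < n - q)%N then 2 * i%:R + 1 - n%:R else L.
Local Notation F := kite_profile.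
Local Notation e := (@kite n q).

Let n1 : (1 < n)%N. Proof. lia. Qed.

Let L1 : 1 <= L.
Proof. by rewrite /L lerBrDr addrC lerD2r -natrM ler_nat. Qed.

(** The increments are 0 or 2, so a squared increment is twice the increment and the energy
    telescopes. *)
Lemma kite_profileS i : (F i.+1 - F i) ^+ 2 = 2 * (F i.+1 - F i) /\ F i <= F i.+1.
Proof.
have D : F i.+1 - F i = 0 \/ F i.+1 - F i = 2.
{ rewrite /F /L; case: (ltnP i.+1 q) => h1; case: (ltnP i q) => h2;
    case: (ltnP i.+1 (n - q)) => h3; case: (ltnP i (n - q)) => h4; try (exfalso; lia);
    rewrite -?[i.+1%:R]natr1.
  all: try have E : i%:R + 1 = q%:R :> R by rewrite natr1; congr _%:R; lia.
  all: try have E' : i%:R + 1 = n%:R - q%:R :> R by rewrite natr1 -natrB; [congr _%:R; lia|lia].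
  all: by first [left; lra | right; lra]. }
by rewrite -subr_ge0; case: D => ->; split=> //; ring.
Qed.

Lemma kite_profile_rev (i : 'I_n) : F (rev_ord i) = - F i.
Proof.
have ni := ltn_ord i; rewrite /F /=.
case: (ltnP i q) => h1; case: (ltnP i (n - q)) => h2;
  case: (ltnP (n - i.+1) q) => h3; case: (ltnP (n - i.+1) (n - q)) => h4;
  try (exfalso; lia); rewrite ?opprK //.
rewrite natrB // -[i.+1%:R]natr1; ring.
Qed.

Lemma kite_rev (i j : 'I_n) : e (rev_ord i) (rev_ord j) = e i j.
Proof.
have ni := ltn_ord i; have nj := ltn_ord j.
by rewrite /kite (inj_eq rev_ord_inj) /=; congr (_ && _); apply/idP/idP; lia.
Qed.

(** Reversing the vertices preserves the graph, hence the degrees, and negates the profile. *)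
Lemma kite_balanced : \sum_(i < n) deg R e i * F i = 0.
Proof.
set s := \sum_i _; have : s = - s.
  rewrite {1}/s (reindex_inj rev_ord_inj) /s -sumrN; apply: eq_bigr => i _.
  rewrite kite_profile_rev mulrN; congr (- (_ * _)); rewrite !degE.
  by rewrite (reindex_inj rev_ord_inj); apply: eq_bigr => j _; rewrite kite_rev.
lra.
Qed.

Lemma kite_energy : energy e (fun i => F i) <= 8 * L.
Proof.
(* [up] charges each forward path step; its total telescopes to at most 2 (F n - F 0) = 4L, and the
   two orientations give 8L. Any other edge lies inside a clique, where the profile is constant. *)
pose up (i j : 'I_n) : R := (i.+1 == j :> nat)%:R * (2 * (F i.+1 - F i)).
have up0 i j : 0 <= up i j.
  by rewrite mulr_ge0 // mulr_ge0 // subr_ge0; case: (kite_profileS i).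
have sum_up : \sum_i \sum_j up i j <= 4 * L.
  apply: le_trans (_ : \sum_(i < n) (2 * (F i.+1 - F i)) <= _).
    apply: ler_sum => i _; rewrite -mulr_suml ler_piMl //.
      by rewrite mulr_ge0 // subr_ge0; case: (kite_profileS i).
    have -> : \sum_(j < n) (i.+1 == j :> nat)%:R = #|[set j : 'I_n | i.+1 == j]|%:R :> R.
      rewrite -sum1_card natr_sum [RHS]big_mkcond; apply: eq_bigr => j _.
      by rewrite inE; case: eqP.
    rewrite (ler_nat _ _ 1); apply/card_le1_eqP => j k; rewrite !inE => /eqP ij /eqP ik.
    by apply: val_inj; rewrite /= -ij -ik.
  rewrite -mulr_sumr -(big_mkord predT (fun i => F i.+1 - F i)) telescope_sumr //.
  have -> : F n = L by rewrite /F !ifF //; lia.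
  have -> : F 0 = - L by rewrite /F ifT //; lia.
  lra.
apply: le_trans (_ : \sum_i \sum_j (up i j + up j i) <= _); last first.
  under eq_bigr do rewrite big_split.
  rewrite big_split /= [X in _ + X]exchange_big /=; lra.
apply: ler_sum => i _; apply: ler_sum => j _.
rewrite /kite; case: (i != j) => /=; last by rewrite mul0r addr_ge0.
have [/eqP ij|ij] := boolP (i.+1 == j).
  have [s1 _] := kite_profileS i.
  rewrite /up !orbT mul1r -ij eqxx mul1r -[F i - _]opprB sqrrN s1 lerDl.
  by have := up0 j i; rewrite /up ij.
have [/eqP ji|ji] := boolP (j.+1 == i).
  have [s1 _] := kite_profileS j.
  rewrite /up !orbT mul1r -ji eqxx mul1r s1 lerDr.
  by have := up0 i j; rewrite /up ji.
rewrite !orbF; case: (boolP (_ || _)) => [|_]; last by rewrite mul0r addr_ge0.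
move=> c; have -> : F i = F j.
  rewrite /F; case: (ltnP i q) => h1; case: (ltnP j q) => h2;
    case: (ltnP i (n - q)) => h3; case: (ltnP j (n - q)) => h4 //; exfalso; lia.
by rewrite subrr expr0n mulr0 addr_ge0.
Qed.

(** Only the 2q clique vertices are counted, each of degree at least q - 1 and with squared profile
    L^2. *)
Lemma kite_mass : 2 * q%:R * (q%:R - 1) * L ^+ 2 <= \sum_(i < n) deg R e i * F i ^+ 2.
Proof.
have cl : #|[set i : 'I_n | (i < q)%N]| = q.
  rewrite -sum1_card (eq_bigl (fun i : 'I_n => (i < q)%N)); last by move=> i; rewrite inE.
  by rewrite big_ord_narrow ?sum1_card ?card_ord //; lia.
have cr : #|[set i : 'I_n | (n - q <= i)%N]| = q.
  rewrite -[RHS]cl -[RHS](card_imset _ (@rev_ord_inj n)); apply: eq_card => i.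
  rewrite inE; apply/idP/imsetP => [h|[j]].
    by exists (rev_ord i); rewrite ?rev_ordK // inE /=; have := ltn_ord i; lia.
  by rewrite inE => h -> /=; lia.
have dge (A : {set 'I_n}) i : #|A| = q -> i \in A -> {in A, forall j, (i != j) = e i j} ->
    q%:R - 1 <= deg R e i.
  move=> cA iA eA.
  rewrite lerBlDr natr1 ler_nat -[leqLHS]cA (cardsD1 i A) iA add1n ltnS subset_leq_card //.
  apply/subsetP => j; rewrite !inE => /andP[ji jA].
  by rewrite -eA // eq_sym.
pose G (i : 'I_n) : R := ((i < q)%N%:R + (n - q <= i)%N%:R) * ((q%:R - 1) * L ^+ 2).
have q1 : 0 <= q%:R - 1 :> R by rewrite subr_ge0 ler1n; lia.
apply: le_trans (_ : \sum_i G i <= _).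
  rewrite -mulr_suml big_split /=.
  have cnt (P : pred 'I_n) : \sum_(i < n) (P i)%:R = #|[set i | P i]|%:R :> R.
    rewrite -sum1_card natr_sum [RHS]big_mkcond; apply: eq_bigr => i _.
    by rewrite inE; case: (P i).
  rewrite !cnt cl cr; lra.
apply: ler_sum => i _; rewrite /G.
have d0 : 0 <= deg R e i by rewrite ler0n.
have [il|il] := ltnP i q.
  have -> : (n - q <= i)%N = false by lia.
  rewrite addr0 mul1r /F il sqrrN ler_wpM2r ?sqr_ge0 //.
  apply: (dge _ _ cl); rewrite ?inE // => j; rewrite inE => jl.
  by rewrite /kite il jl /= andbT.
have [ir|ir] := leqP (n - q) i; last by rewrite addr0 mul0r mulr_ge0 ?sqr_ge0.
rewrite add0r mul1r /F ltnNge il /= ltnNge ir /= ler_wpM2r ?sqr_ge0 //.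
apply: (dge _ _ cr); rewrite ?inE // => j; rewrite inE => jr.
by rewrite /kite ir jr /= orbT andbT.
Qed.

(** Compares energy 8L with the mass bound. Nonnegativity of [lambda1] allows multiplication by that
    bound; the lower bound for [alpha] supplies it. *)
Lemma kite_lambda1 : 0 <= lambda1 R e -> lambda1 R e * (q%:R * (q%:R - 1) * L) <= 2.
Proof.
move=> lam0.
have nz : exists i : 'I_n, F i != 0.
  exists (Ordinal (ltnW n1)); rewrite /F /= (_ : (0 < q)%N); last lia.
  by rewrite oppr_eq0 gt_eqF ?(lt_le_trans ltr01 L1).
have := lambda1_le n1 (kite_simple n q) (@kite_connected n q) kite_balanced nz.
move=> /le_trans/(_ kite_energy).
have lam2 : 0 <= 2 * lambda1 R e by rewrite mulr_ge0.
move=> /(le_trans (ler_wpM2l lam2 kite_mass)) le8.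
have L0 : 0 < L := lt_le_trans ltr01 L1.
rewrite -(ler_pM2r L0).
have -> : lambda1 R e * (q%:R * (q%:R - 1) * L) * L =
  2 * lambda1 R e * (2 * q%:R * (q%:R - 1) * L ^+ 2) / 4 by field.
rewrite ler_pdivrMr //; apply: le_trans le8 _.
by rewrite mulrAC -natrM.
Qed.

End Kite.

(** * Existence of the minimum and its asymptotics *)

Section Alpha.
Variables (R : archiRcfType) (n : nat).

Lemma eq_lambda1 (e e' : rel 'I_n) : e =2 e' -> lambda1 R e = lambda1 R e'.
Proof.
move=> ee; suff E : norm_lap R e = norm_lap R e' by rewrite /lambda1 /is_lambda1 E.
have de i : deg R e i = deg R e' i by rewrite !degE; apply: eq_bigr => j _; rewrite ee.
by apply/matrixP => i j; rewrite !mxE ee !de.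
Qed.

(** Encoding relations as boolean finite functions leaves finitely many candidates, so a minimum
    exists as soon as one graph is available. *)
Lemma alphaP : is_alpha n (alpha R n).
Proof.
apply: epsilon_spec.
pose rg (g : {ffun 'I_n * 'I_n -> bool}) : rel 'I_n := fun i j => g (i, j).
pose ok g := [&& [forall i, ~~ rg g i i], [forall i, forall j, rg g i j == rg g j i]
               & [forall i, forall j, connect (rg g) i j]].
have okP g : reflect (simple_graph (rg g) /\ connected_graph (rg g)) (ok g).
  apply: (iffP and3P) => [[/forallP h1 /forallP h2 /forallP h3]|[[h1 h2] h3]].
    split; first by split=> // i j; have /forallP/(_ j)/eqP := h2 i.
    by move=> i j; have /forallP/(_ j) := h3 i.
  split; apply/forallP => i //; apply/forallP => j; last exact: h3.
  by rewrite h2.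
pose of_rel (e : rel 'I_n) := [ffun ij : 'I_n * 'I_n => e ij.1 ij.2].
have rgK e : rg (of_rel e) =2 e by move=> i j; rewrite /rg ffunE.
have ok_rel e : simple_graph e -> connected_graph e -> ok (of_rel e).
  move=> [h1 h2] h3; apply/okP; split; first by split=> [i|i j]; rewrite !rgK.
  by move=> i j; rewrite (eq_connect (rgK e)).
(* The path on [n] vertices shows that the family is nonempty for every [n]. *)
have ok0 := ok_rel _ (kite_simple n 0) (@kite_connected n 0).
case: (Order.TotalTheory.arg_minP (fun g => lambda1 R (rg g)) ok0) => g /okP[sg cg] gmin.
exists (lambda1 R (rg g)); split; first by exists (rg g).
by move=> e se ce; rewrite -(eq_lambda1 (rgK e)) gmin // ok_rel.
Qed.

End Alpha.

Lemma alpha_lower (R : archiRcfType) (n : nat) : (1 < n)%N ->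
  54 <= alpha R n * (n%:R ^+ 3 + 3240 * n%:R ^+ 2).
Proof.
by move=> n1; have [[e [se ce <-]] _] := alphaP R n; apply: lambda1_lower.
Qed.

Lemma alpha_upper (R : archiRcfType) (n : nat) : (6 <= n)%N ->
  alpha R n * (n%:R * (n%:R - 2) * (n%:R - 5)) <= 54.
Proof.
move=> n6; have [_ amin] := alphaP R n.
have a0 : 0 < alpha R n.
  have := alpha_lower R (n := n) ltac:(lia).
  have : 0 <= n%:R ^+ 3 + 3240 * n%:R ^+ 2 :> R by rewrite addr_ge0 ?mulr_ge0 ?exprn_ge0.
  rewrite ltNge => p h; apply/negP => /(ler_wpM2r p); rewrite mul0r; lra.
pose q := (n %/ 3)%N.
have q2 : (2 <= q)%N by rewrite /q; lia.
have qn : (2 * q <= n)%N by rewrite /q; lia.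
have ale := amin _ (kite_simple n q) (@kite_connected n q).
have := kite_lambda1 q2 qn (le_trans (ltW a0) ale).
set x : R := n%:R; set y : R := q%:R; set lam := lambda1 _ _ in ale *.
have xy1 : 3 * y <= x by rewrite -natrM ler_nat /q; lia.
have xy2 : x - 2 <= 3 * y by rewrite lerBlDr -natrM -natrD ler_nat /q; lia.
have x6 : 6 <= x by rewrite ler_nat.
move=> lub; apply: le_trans (_ : lam * (27 * (y * (y - 1) * (x + 1 - 2 * y))) <= _); last lra.
apply: ler_pM => //; first exact: ltW.
  by rewrite !mulr_ge0 //; lra.
(* From x - 2 <= 3y <= x, the three factors are at least x, x - 2 and x - 5 respectively. *)
have -> : 27 * (y * (y - 1) * (x + 1 - 2 * y)) =
  3 * (x + 1 - 2 * y) * (3 * y) * (3 * y - 3) by ring.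
apply: ler_pM; [by rewrite !mulr_ge0 //; lra|lra| |lra].
apply: ler_pM; lra.
Qed.

Lemma relative_error (R : realFieldType) (a x eps : R) :
  10 <= x -> 3240 < eps * x -> 54 <= a * (x ^+ 3 + 3240 * x ^+ 2) ->
  a * (x * (x - 2) * (x - 5)) <= 54 -> `| a * x ^+ 3 / 54 - 1 | < eps.
Proof.
move=> x10 xe lo up.
have ax0 : 0 < a * x ^+ 2.
  rewrite ltNge; apply/negP => h.
  have : a * x ^+ 2 * (x + 3240) <= 0 by rewrite mulr_le0_ge0 //; lra.
  have -> : a * x ^+ 2 * (x + 3240) = a * (x ^+ 3 + 3240 * x ^+ 2) by ring.
  lra.
(* With t = a x^2 both bounds become linear in x: t (x - 9) <= 54 <= t (x + 3240). *)
have up' : a * x ^+ 2 * (x - 9) <= 54.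
  apply: le_trans up; have a0 : 0 < a.
    by move: ax0; rewrite pmulr_lgt0 // exprn_gt0 //; lra.
  have -> : a * x ^+ 2 * (x - 9) = a * (x ^+ 3 - 9 * x ^+ 2) by ring.
  rewrite ler_pM2l //; nra.
have -> : a * x ^+ 3 = a * x ^+ 2 * x by ring.
have {lo} : 54 <= a * x ^+ 2 * (x + 3240) by lra.
move: (a * x ^+ 2) ax0 up' => t t0 up' lo {a up}.
have t54 : t <= 54 by apply: le_trans up'; rewrite ler_peMr ?(ltW t0) //; lra.
have x0 : 0 < x by lra.
have lt_eps r : r * x <= 3240 -> r < eps.
  by move=> rx; rewrite -(ltr_pM2r x0) (le_lt_trans rx).
(* The relative error is at most 60 t when t x < 54, since 3240/54 = 60, and at most t/6 otherwise,
   since 9/54 = 1/6. Both are at most 3240/x. *)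
have [tx|tx] := leP 54 (t * x); last first.
  rewrite ltr0_norm; last lra.
  suff : 60 * t < eps by lra.
  by apply: lt_eps; lra.
rewrite ger0_norm; last lra.
suff : t / 6 < eps by lra.
by apply: lt_eps; lra.
Qed.

Theorem theorem1p4 (R : archiRcfType) :
  forall eps : R, 0 < eps ->
  exists N : nat, forall n : nat, (N <= n)%N ->
    `| alpha R n * (n%:R ^+ 3) / 54 - 1 | < eps.
Proof.
move=> eps eps0.
have [M Mlt] : exists M : nat, 3240 / eps < M%:R.
  by exists (Num.bound (3240 / eps)); apply: archi_boundP; rewrite divr_ge0 // ltW.
exists (maxn 10 M) => n; rewrite geq_max => /andP[n10 Mn].
apply: relative_error; first by rewrite ler_nat.
- rewrite mulrC -ltr_pdivrMr //; apply: lt_le_trans Mlt _; by rewrite ler_nat.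
- by apply: alpha_lower; lia.
by apply: alpha_upper; lia.
Qed.
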